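(* Let $(R,\mathfrak m)$ be a Cohen-Macaulay local ring with infinite residue field and positive dimension $d$, let $I$ be an $\mathfrak m$-primary ideal of $R$ containing a parameter ideal $Q=(x_1,\ldots,x_d)$ as a reduction, and let $M$ be a maximal Cohen-Macaulay $R$-module. Then $\mathrm e^1_I(M)\ge 0$, and the following assertions are equivalent: (i) $M$ is an Ulrich $R$-module with respect to $I$; (ii) $M/IM$ is a free $R/I$-module and $\mathrm e^1_I(M)=0$.
   Context: All rings are commutative and Noetherian with 1. A finitely generated $R$-module $M$ is maximal Cohen-Macaulay if $\mathrm{depth}_R M=\dim R$ (the zero module, of depth $+\infty$, is not). A parameter ideal is an ideal generated by a system of parameters. That $Q\subset I$ is a reduction of $I$ means $QI^r=I^{r+1}$ for some $r\ge 0$. A finitely generated $R$-module $M$ is Ulrich with respect to $I$ if $M$ is maximal Cohen-Macaulay, $IM=QM$, and $M/IM$ is a free $R/I$-module. For a $d$-dimensional $M$, the Hilbert coefficients $\mathrm e^i_I(M)$ are the integers such that $\ell_R(M/I^kM)=\sum_{i=0}^d(-1)^i\mathrm e^i_I(M)\binom{k+d-i-1}{d-i}$ for all $k\gg 0$, where $\ell_R$ denotes length; $\mathrm e^1_I(M)$ is called the Chern number of $M$ with respect to $I$. *)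

(* Defs.v *)
From HB Require Import structures.
From mathcomp Require Import all_boot all_order all_algebra.
From mathcomp Require Import all_classical.

Set Implicit Arguments.
Unset Strict Implicit.
Unset Printing Implicit Defensive.

Import Order.TTheory GRing.Theory Num.Theory.
Local Open Scope classical_set_scope.
Local Open Scope ring_scope.

(* Mathematical Components.  Submodules and ideals are Prop-valued sets, and a
   quotient M/N is handled through the submodule N of M: a statement about
   elements of M/N is a statement about elements of M modulo N, and the
   submodules of M/N are the submodules of M that contain N. *)

Section Modules.
Variables (R : comNzRingType) (M : lmodType R).
Implicit Types (I : set R) (N A : set M).

Definition submodule N : Prop :=
  N 0 /\ forall (a : R) (u v : M), N u -> N v -> N (a *: u + v).

Definition span A : set M := smallest submodule A.

(* I N, the submodule generated by the products a *: u *)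
Definition smul I N : set M :=
  span [set w | exists a u, [/\ I a, N u & w = a *: u]].

Definition finitely_generated : Prop :=
  exists s : seq M, span [set` s] = setT.

(* N <= F 0 < ... < F n <= M *)
Definition has_submodule_chain N (n : nat) : Prop :=
  exists F : nat -> set M,
    (forall i, (i <= n)%N -> submodule (F i) /\ N `<=` F i) /\
    (forall i, (i < n)%N -> F i `<` F i.+1).

(* the length of M/N is finite and equal to n *)
Definition quot_length N (n : nat) : Prop :=
  has_submodule_chain N n /\
  forall n', has_submodule_chain N n' -> (n' <= n)%N.

End Modules.

Arguments finitely_generated {R} M.

Section Ideals.
Variable R : comNzRingType.
Implicit Types (I J P Q m : set R).

(* Ideals are the submodules of the regular module R^o. *)
Definition ideal I : Prop := @submodule R R^o I.

Definition ideal_gen (A : set R) : set R := @span R R^o A.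

Definition ideal_mul I J : set R := @smul R R^o I J.

Definition ideal_exp I (k : nat) : set R := iter k (ideal_mul I) setT.

Definition noetherian : Prop :=
  forall I, ideal I -> exists s : seq R, I = ideal_gen [set` s].

Definition maximal_ideal m : Prop :=
  [/\ ideal m, m <> setT &
      forall J, ideal J -> m `<=` J -> J = m \/ J = setT].

Definition local_ring m : Prop :=
  maximal_ideal m /\ forall J, maximal_ideal J -> J = m.

(* the set of cosets a + m is infinite *)
Definition infinite_residue_field m : Prop :=
  infinite_set (range (fun a : R => [set a + u | u in m])).

Definition prime_ideal P : Prop :=
  [/\ ideal P, P <> setT & forall a b, P (a * b) -> P a \/ P b].

Definition radical I : set R := [set a | exists n : nat, I (a ^+ n)].

Definition primary_ideal I : Prop :=
  [/\ ideal I, I <> setT & forall a b, I (a * b) -> I a \/ radical I b].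

Definition primary_to m I : Prop := primary_ideal I /\ radical I = m.

Definition has_prime_chain (n : nat) : Prop :=
  exists P : nat -> set R,
    (forall i, (i <= n)%N -> prime_ideal (P i)) /\
    (forall i, (i < n)%N -> P i `<` P i.+1).

(* the Krull dimension of R is finite and equal to d *)
Definition krull_dim (d : nat) : Prop :=
  has_prime_chain d /\ forall n, has_prime_chain n -> (n <= d)%N.

Definition system_of_parameters m (d : nat) (x : d.-tuple R) : Prop :=
  krull_dim d /\ primary_to m (ideal_gen [set` x]).

Definition reduction I Q : Prop :=
  Q `<=` I /\ exists r, ideal_mul Q (ideal_exp I r) = ideal_exp I r.+1.

End Ideals.

Arguments noetherian R : clear implicits.
Arguments krull_dim R d : clear implicits.

Section CohenMacaulay.
Variables (R : comNzRingType) (m : set R) (M : lmodType R).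

Definition regular_sequence (s : seq R) : Prop :=
  (forall i, (i < size s)%N ->
     let N : set M := smul (ideal_gen [set` take i s]) setT in
     forall u : M, N (s`_i *: u) -> N u) /\
  smul (ideal_gen [set` s]) [set: M] <> setT.

(* The depth of M is finite and equal to n, for M finitely generated over a
   Noetherian local ring with maximal ideal m.  The zero module has no regular
   sequence, not even the empty one, so it has no finite depth. *)
Definition depth (n : nat) : Prop :=
  (exists s : seq R,
     [/\ [set` s] `<=` m, regular_sequence s & size s = n]) /\
  forall s : seq R, [set` s] `<=` m -> regular_sequence s -> (size s <= n)%N.

Definition maximal_Cohen_Macaulay : Prop :=
  finitely_generated M /\ exists2 d, krull_dim R d & depth d.

End CohenMacaulay.

Definition Cohen_Macaulay_local_ring (R : comNzRingType) (m : set R) : Prop :=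
  [/\ noetherian R, local_ring m & exists2 d, krull_dim R d & depth m R^o d].

Section Ulrich.
Variables (R : comNzRingType) (M : lmodType R).
Implicit Types (I Q m : set R).

(* M/IM is free over R/I: the classes of b_0, ..., b_(n-1) form a basis.  The
   rank is finite because M is finitely generated wherever this is used. *)
Definition quot_free I : Prop :=
  exists (n : nat) (b : 'I_n -> M),
    (forall u : M, exists c : 'I_n -> R,
       smul I [set: M] (u - \sum_(i < n) c i *: b i)) /\
    (forall c : 'I_n -> R,
       smul I [set: M] (\sum_(i < n) c i *: b i) -> forall i, I (c i)).

(* Q is meant to be a parameter ideal that is a reduction of I. *)
Definition Ulrich m I Q : Prop :=
  [/\ maximal_Cohen_Macaulay m M,
      smul I [set: M] = smul Q [set: M] &
      quot_free I].

(* e 0, ..., e d are the Hilbert coefficients of M, of dimension d, with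
   respect to I; the values e i for i > d are irrelevant. *)
Definition Hilbert_coefficients I (d : nat) (e : nat -> int) : Prop :=
  exists k0 : nat, forall k : nat, (k0 <= k)%N ->
    exists2 l : nat, quot_length (smul (ideal_exp I k) [set: M]) l &
      l%:Z = \sum_(i < d.+1)
               (-1) ^+ i * e i * ('C(k + d - i - 1, d - i))%:Z.

End Ulrich.

Arguments quot_free {R} M I.
Arguments Ulrich {R} M m I Q.
Arguments Hilbert_coefficients {R} M I d e.
Arguments depth {R} m M n.
Arguments maximal_Cohen_Macaulay {R} m M.

(* Main.v *)
Require Import Defs.
From HB Require Import structures.
From mathcomp Require Import all_boot all_order all_algebra.
From mathcomp Require Import all_classical.
From mathcomp Require Import zify.

Set Implicit Arguments.
Unset Strict Implicit.
Unset Printing Implicit Defensive.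

Import Order.TTheory GRing.Theory Num.Theory.
Local Open Scope classical_set_scope.
Local Open Scope ring_scope.

(** Let E and L be the lengths of M/QM and M/IM; L <= E, with equality iff
    IM = QM.

    The sequence x is M-regular in any order.  Indeed a maximal M-regular
    sequence y has d terms and powers of its terms lie in Q, so that peeling off
    the y_j one by one kills the Koszul homology H_i(x; M) for i > 0, and
    Nakayama's lemma turns this vanishing into regularity.  Therefore
    M/Q^n M has length E * C(n+d-1, d).

    Filtering along x, M/(Q^n I M) has length at most
    E * C(n+d-1, d) + L * C(n+d-1, d-1).  Since Q^n I M is contained in
    I^(n+1) M and I^(n+r) M in Q^n M, comparing these lengths with the Hilbert
    polynomial yields e^0 = E and Northcott's inequality e^1 >= E - L >= 0, so
    e^1 = 0 forces IM = QM.  Conversely, if IM = QM then I^n M = Q^n M, which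
    gives e^1 <= 0. *)

(** * Submodules and products with ideals *)

Section Submodules.
Variables (R : comNzRingType) (M : lmodType R).
Implicit Types (N A B W : set M) (s : seq R) (w : R).

Lemma submodZ N a u : submodule N -> N u -> N (a *: u).
Proof. by move=> [N0 h] Nu; rewrite -[_ *: _]addr0; apply: h. Qed.

Lemma submodD N u v : submodule N -> N u -> N v -> N (u + v).
Proof. by move=> [N0 h] Nu Nv; rewrite -[u]scale1r; apply: h. Qed.

Lemma submodN N u : submodule N -> N u -> N (- u).
Proof. by move=> hN Nu; rewrite -scaleN1r; apply: submodZ. Qed.

Lemma submodB N u v : submodule N -> N u -> N v -> N (u - v).
Proof. by move=> hN Nu Nv; apply: submodD => //; apply: submodN. Qed.

Lemma submodule_setT : submodule [set: M].
Proof. by []. Qed.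

Lemma submodule_set0 : submodule [set (0 : M)].
Proof. by split=> // a u v -> ->; rewrite scaler0 addr0. Qed.

Lemma span_submodule A : submodule (Defs.span A).
Proof.
split=> [B [[B0 _] _] //|a u v hu hv B hB].
by apply: hB.1.2; [apply: hu|apply: hv].
Qed.

Lemma sub_span A : A `<=` Defs.span A.
Proof. exact: sub_gen_smallest. Qed.

Lemma span_min A N : submodule N -> A `<=` N -> Defs.span A `<=` N.
Proof. exact: smallest_sub. Qed.

Definition addset A B : set M := [set u | exists a b, [/\ A a, B b & u = a + b]].

Definition scaleset w A : set M := [set u | exists2 a, A a & u = w *: a].

(** The product [(s) N] as an iterated sum, so that generators can be split off one at a time;
    [smul_gen] identifies it with the product by the generated ideal. *)
Definition seqmul s N : set M :=
  foldr (fun w A => addset (scaleset w N) A) [set 0] s.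

Lemma submodule_addset A B :
  submodule A -> submodule B -> submodule (addset A B).
Proof.
move=> hA hB; split.
  by exists 0, 0; rewrite addr0; split=> //; [case: hA|case: hB].
move=> c _ _ [a [b [Aa Bb ->]]] [a' [b' [Aa' Bb' ->]]].
exists (c *: a + a'), (c *: b + b'); split; [exact: hA.2|exact: hB.2|].
by rewrite scalerDr addrACA.
Qed.

Lemma submodule_scaleset w A : submodule A -> submodule (scaleset w A).
Proof.
move=> hA; split; first by exists 0; rewrite ?scaler0 //; case: hA.
move=> c _ _ [a Aa ->] [b Ab ->]; exists (c *: a + b); first exact: hA.2.
by rewrite scalerDr !scalerA mulrC.
Qed.

Lemma addset_subl A B : submodule B -> A `<=` addset A B.
Proof. by move=> [B0 _] u Au; exists u, 0; rewrite addr0. Qed.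

Lemma addset_subr A B : submodule A -> B `<=` addset A B.
Proof. by move=> [A0 _] u Bu; exists 0, u; rewrite add0r. Qed.

Lemma addset_min A B N : submodule N -> A `<=` N -> B `<=` N -> addset A B `<=` N.
Proof. by move=> hN AN BN _ [a [b [/AN Na /BN Nb ->]]]; apply: submodD. Qed.

Lemma addsetS A A' B B' :
  A `<=` A' -> B `<=` B' -> addset A B `<=` addset A' B'.
Proof. by move=> sA sB _ [a [b [/sA Aa /sB Bb ->]]]; exists a, b. Qed.

Lemma scalesetS w A B : A `<=` B -> scaleset w A `<=` scaleset w B.
Proof. by move=> AB _ [a /AB Ba ->]; exists a. Qed.

Lemma submodule_seqmul s N : submodule N -> submodule (seqmul s N).
Proof.
move=> hN; elim: s => [|w s IH] /=; first exact: submodule_set0.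
by apply: submodule_addset => //; apply: submodule_scaleset.
Qed.

Lemma seqmul_sub s N : submodule N -> seqmul s N `<=` N.
Proof.
move=> hN; elim: s => [|w s IH] /=; first by move=> _ ->; case: hN.
by apply: addset_min => // _ [a Na ->]; apply: submodZ.
Qed.

Lemma seqmulS s A B : A `<=` B -> seqmul s A `<=` seqmul s B.
Proof.
by move=> AB; elim: s => [//|w s IH] /=; apply: addsetS => //; apply: scalesetS.
Qed.

Lemma mem_seqmul s w N u :
  submodule N -> w \in s -> N u -> seqmul s N (w *: u).
Proof.
move=> hN + Nu; elim: s => [//|v s IH] /=; rewrite inE => /orP[/eqP <-|ws].
  by apply: addset_subl; [apply: submodule_seqmul|exists u].
by apply: addset_subr; [apply: submodule_scaleset|apply: IH].
Qed.

Lemma smulS (I J : set R) A B : I `<=` J -> A `<=` B -> smul I A `<=` smul J B.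
Proof.
move=> IJ AB; apply: span_min; first exact: span_submodule.
by move=> _ [a [u [/IJ Ja /AB Bu ->]]]; apply: sub_span; exists a, u.
Qed.

Lemma mem_smul (I : set R) N a u : I a -> N u -> smul I N (a *: u).
Proof. by move=> Ia Nu; apply: sub_span; exists a, u. Qed.

Lemma smul_submodule (I : set R) N : submodule (smul I N).
Proof. exact: span_submodule. Qed.

Lemma smul_sub (I : set R) N : submodule N -> smul I N `<=` N.
Proof. by move=> hN; apply: span_min => // _ [a [u [_ Nu ->]]]; apply: submodZ. Qed.

End Submodules.

Lemma ideal_gen_min (R : comNzRingType) (A J : set R) :
  ideal J -> A `<=` J -> ideal_gen A `<=` J.
Proof. exact: (@span_min R R^o). Qed.

Lemma sub_ideal_gen (R : comNzRingType) (A : set R) : A `<=` ideal_gen A.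
Proof. exact: (@sub_span R R^o). Qed.

Lemma ideal_gen_ideal (R : comNzRingType) (A : set R) : ideal (ideal_gen A).
Proof. exact: (@span_submodule R R^o). Qed.

Lemma smul_gen (R : comNzRingType) (M : lmodType R) s (N : set M) :
  submodule N -> smul (ideal_gen [set` s]) N = seqmul s N.
Proof.
move=> hN; have hsm := submodule_seqmul s hN; apply/seteqP; split.
  apply: span_min => // _ [a [u [+ Nu ->]]]; move: a.
  (* For fixed [u], the scalars taking [u] into a submodule form an ideal, so only the generators
     need checking. *)
  suff h : ideal_gen [set` s] `<=` [set a | seqmul s N (a *: u)] by exact: h.
  apply: ideal_gen_min => [|a /= sa]; last exact: mem_seqmul.
  split; first by rewrite /= scale0r; case: hsm.
  by move=> c a b /= ha hb; rewrite scalerDl -scalerA; apply: hsm.2.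
elim: s {hsm} => [|w s IH] /=.
  by move=> _ ->; case: (smul_submodule (ideal_gen [set` [::]]) N).
apply: addset_min; first exact: span_submodule.
  move=> _ [u Nu ->]; apply: mem_smul => //.
  by apply: sub_ideal_gen; rewrite /= mem_head.
apply: subset_trans IH _; apply: smulS => //.
apply: ideal_gen_min; first exact: ideal_gen_ideal.
by move=> a /= sa; apply: sub_ideal_gen; rewrite /= inE sa orbT.
Qed.

(** * Products of ideals and their powers acting on submodules *)

Section PowersOfIdeals.
Variables (R : comNzRingType) (M : lmodType R).
Implicit Types (N A B W : set M) (s : seq R) (I J : set R).

Lemma smulA I J N : smul (ideal_mul I J) N = smul I (smul J N).
Proof.
apply/seteqP; split.
  apply: span_min; first exact: smul_submodule.
  move=> _ [a [u [+ Nu ->]]]; move: a.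
  have hI := smul_submodule I (smul J N).
  suff h : ideal_mul I J `<=` [set a | smul I (smul J N) (a *: u)] by exact: h.
  apply: ideal_gen_min.
    split; first by rewrite /= scale0r; case: hI.
    by move=> c a b /= ha hb; rewrite scalerDl -scalerA; apply: hI.2.
  move=> _ [a [b [Ia Jb ->]]] /=; rewrite -scalerA.
  by apply: mem_smul => //; apply: mem_smul.
apply: span_min; first exact: smul_submodule.
move=> _ [a [u [Ia + ->]]]; move: u.
have hI := smul_submodule (ideal_mul I J) N.
suff h : smul J N `<=` [set u | smul (ideal_mul I J) N (a *: u)] by exact: h.
apply: span_min.
  split; first by rewrite /= scaler0; case: hI.
  move=> c u v /= hu hv; rewrite scalerDr scalerA mulrC -scalerA.
  exact: hI.2.
move=> _ [b [u [Jb Nu ->]]] /=; rewrite scalerA; apply: mem_smul => //.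
by rewrite /ideal_mul; apply: (@mem_smul _ R^o I J a b).
Qed.

Lemma smulC I J N : smul I (smul J N) = smul J (smul I N).
Proof.
have le I' J' : smul I' (smul J' N) `<=` smul J' (smul I' N); last first.
  by apply/seteqP; split; apply: le.
apply: span_min; first exact: smul_submodule.
move=> _ [a [u [Ia + ->]]]; move: u.
have hJ := smul_submodule J' (smul I' N).
suff h : smul J' N `<=` [set u | smul J' (smul I' N) (a *: u)] by exact: h.
apply: span_min.
  split; first by rewrite /= scaler0; case: hJ.
  by move=> c u v /= hu hv; rewrite scalerDr scalerA mulrC -scalerA; apply: hJ.2.
move=> _ [b [u [Jb Nu ->]]] /=; rewrite scalerA mulrC -scalerA.
by apply: mem_smul => //; apply: mem_smul.
Qed.

Lemma smul_exp I k :
  smul (ideal_exp I k) [set: M] = iter k (smul I) [set: M].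
Proof.
elim: k => [|k IH] /=; last by rewrite smulA IH.
by apply/seteqP; split=> // u _; rewrite -[u]scale1r; apply: mem_smul.
Qed.

Lemma iter_smulS I k N N' : N `<=` N' -> iter k (smul I) N `<=` iter k (smul I) N'.
Proof. by move=> NN'; elim: k => [//|k IH] /=; apply: smulS. Qed.

Lemma iter_smulC I J n N :
  iter n (smul I) (smul J N) = smul J (iter n (smul I) N).
Proof. by elim: n => [//|n /= ->]; rewrite smulC. Qed.

Lemma iter_smul_submodule I n N : submodule N -> submodule (iter n (smul I) N).
Proof. by case: n => [//|n] _; apply: smul_submodule. Qed.

Lemma iter_smul_sub I n N : submodule N -> iter n (smul I) N `<=` N.
Proof.
move=> hN; elim: n => [//|n IH] /=; apply: subset_trans IH.
by apply: smul_sub; apply: iter_smul_submodule.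
Qed.

Lemma iter_smul_gen s n N : submodule N ->
  iter n (smul (ideal_gen [set` s])) N = iter n (seqmul s) N.
Proof.
move=> hN; elim: n => [//|n /= <-]; rewrite smul_gen //.
exact: iter_smul_submodule.
Qed.

(** The equation [Q I^r M = I^(r+1) M] trades one factor [I] for [Q]; as products commute, the trade
    can be repeated for all [n] extra factors. *)
Lemma reduction_power I Q r n :
  ideal_mul Q (ideal_exp I r) = ideal_exp I r.+1 ->
  iter (n + r) (smul I) [set: M] = iter n (smul Q) (iter r (smul I) [set: M]).
Proof.
move=> e; have {}e : smul Q (iter r (smul I) [set: M]) =
    smul I (iter r (smul I) [set: M]).
  by rewrite -smul_exp -smulA e !smul_exp.
by elim: n => [//|n IH]; rewrite addSn /= IH -iter_smulC -e iter_smulC.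
Qed.

Lemma iter_smul_eq I Q n :
  smul I [set: M] = smul Q [set: M] ->
  iter n (smul I) [set: M] = iter n (smul Q) [set: M].
Proof.
move=> e; elim: n => [//|n IH] /=.
by rewrite IH -iter_smulC e iter_smulC.
Qed.

Lemma iter_smul_mixed I Q n : Q `<=` I ->
  iter n (smul Q) (smul I [set: M]) `<=` iter n.+1 (smul I) [set: M].
Proof. by move=> QI; rewrite iterSr; elim: n => [//|n IH] /=; apply: smulS. Qed.

End PowersOfIdeals.

(** * Chains of submodules *)

Section Chains.
Variables (R : comNzRingType) (M : lmodType R).
Implicit Types (N T A B W : set M) (s : seq R) (w : R).

Lemma proper_setP A B : A `<` B <-> A `<=` B /\ exists2 u, B u & ~ A u.
Proof.
split=> [[AB nBA]|[AB [u Bu nAu]]]; last by split=> // /(_ u Bu).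
by split=> //; have /existsNP[u /not_implyP[? ?]] := nBA; exists u.
Qed.

(** A lower bound [n] on the length of [T/N], meaningful without finiteness. The chain need not
    start at [N] or end at [T], so enlarging the interval keeps it valid. *)
Definition chain_between N T (n : nat) : Prop :=
  exists F : nat -> set M,
    (forall i, (i <= n)%N -> [/\ submodule (F i), N `<=` F i & F i `<=` T]) /\
    (forall i, (i < n)%N -> F i `<` F i.+1).

Lemma chain_betweenT N n : has_submodule_chain N n <-> chain_between N setT n.
Proof.
by split=> -[F [hF sF]]; exists F; split=> // i /hF; [case|move=> []].
Qed.

Lemma chain_between0 N T A :
  submodule A -> N `<=` A -> A `<=` T -> chain_between N T 0.
Proof. by move=> *; exists (fun=> A); split. Qed.

Lemma chain_betweenS N N' T T' n :
  N `<=` N' -> T' `<=` T -> chain_between N' T' n -> chain_between N T n.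
Proof.
move=> NN TT [F [hF sF]]; exists F; split=> // i /hF[? NF FT].
by split=> //; [apply: subset_trans NF|apply: subset_trans TT].
Qed.

Lemma chain_between_rcons N T T' n :
  submodule T' -> chain_between N T n -> T `<` T' -> chain_between N T' n.+1.
Proof.
move=> hT' [F [hF sF]] /proper_setP[TT' [u T'u nTu]].
exists (fun i => if (i <= n)%N then F i else T'); split=> i.
  case: (leqP i n) => [/hF[? ? FT] _|_ _]; first by split=> //; apply: subset_trans TT'.
  have [_ NF FT] := hF n (leqnn n).
  by split=> //; apply: subset_trans TT'; apply: subset_trans FT.
rewrite ltnS => ile; rewrite ile; case: (ltnP i n) => [ilt|nle]; first exact: sF.
have -> : i = n by apply/eqP; rewrite eqn_leq ile.
case: (hF n (leqnn n)) => _ _ FT; apply/proper_setP; split.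
  exact: subset_trans TT'.
by exists u => // /FT.
Qed.

Lemma proper_chain_sub (F : nat -> set M) n :
  (forall i, (i < n)%N -> F i `<` F i.+1) ->
  forall i, (i <= n)%N -> F i `<=` F n.
Proof.
elim: n => [_ i|n IH sF i]; first by rewrite leqn0 => /eqP->.
rewrite leq_eqVlt => /predU1P[->//|ile].
apply: subset_trans (properW (sF n (leqnn _))).
by apply: IH => // j jn; apply: sF; apply: leqW.
Qed.

Lemma chain_between_cat N T T' a b :
  chain_between N T a -> chain_between T T' b -> chain_between N T' (a + b).
Proof.
move=> ca; elim: b T' => [|b IH] T'.
  case=> G [hG _]; rewrite addn0; case: (hG 0 isT) => _ TG GT.
  by apply: chain_betweenS ca => //; apply: subset_trans GT.
case=> G [hG sG]; rewrite addnS.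
have cb : chain_between N (G b) (a + b).
  apply: IH; exists G; split=> i ib; last by apply: sG; apply: leqW.
  case: (hG i (leqW ib)) => ? ? _; split=> //.
  by apply: proper_chain_sub ib => j jb; apply: sG; apply: leqW.
have [sb _ Gb] := hG b.+1 (leqnn _).
apply: (@chain_betweenS _ N _ (G b.+1)) => //.
by apply: chain_between_rcons cb _ => //; apply: sG.
Qed.

(* By the modular law, a proper inclusion stays proper after intersecting with
   T or after adding T. *)
Lemma chain_between_split N T n :
  submodule T -> N `<=` T -> chain_between N setT n ->
  exists a b, [/\ (n <= a + b)%N, chain_between N T a & chain_between T setT b].
Proof.
move=> hT NT [F [hF sF]].
suff [a [b [nab ca cb]]] : exists a b, [/\ (n <= a + b)%N,
    chain_between N (F n `&` T) a & chain_between T (addset (F n) T) b].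
  by exists a, b; split=> //; apply: chain_betweenS ca || apply: chain_betweenS cb.
have capT A : submodule A -> submodule (A `&` T).
  move=> hA; split; first by split; [case: hA|case: hT].
  by move=> c u v [? ?] [? ?]; split; [apply: hA.2|apply: hT.2].
elim: n F hF sF => [|n IH] F hF sF.
  have [h0 NF _] := hF 0 isT; exists 0, 0; split=> //.
    apply: (@chain_between0 _ _ (F 0 `&` T)) => //; first exact: capT.
    by move=> u Nu; split; [apply: NF|apply: NT].
  apply: (@chain_between0 _ _ T) => //; exact: addset_subr.
have [|i ile|a [b [nab ca cb]]] := IH F.
- by move=> i ile; apply: hF; apply: leqW.
- by apply: sF; apply: leqW.
have [hn _ _] := hF n (leqW (leqnn n)); have [hn1 _ _] := hF n.+1 (leqnn _).
have /proper_setP[Fs [u Fu nFu]] := sF n (leqnn _).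
have sI : F n `&` T `<=` F n.+1 `&` T by move=> v [/Fs].
have sA : addset (F n) T `<=` addset (F n.+1) T by apply: addsetS.
have [eI|nI] := pselect (F n.+1 `&` T `<=` F n `&` T); last first.
  exists a.+1, b; split; first by rewrite addSn.
    by apply: chain_between_rcons ca _; [exact: capT|split].
  exact: chain_betweenS cb.
exists a, b.+1; split; first by rewrite addnS.
  exact: chain_betweenS ca.
apply: chain_between_rcons cb _; first exact: submodule_addset.
split=> // eA; apply: nFu.
have [|c [t [Fc Tt uE]]] := eA u; first exact: addset_subl.
suff [Ft _] : (F n `&` T) t by rewrite uE; apply: submodD.
apply: eI; split=> //; have -> : t = u - c by rewrite uE addrC addKr.
by apply: submodB => //; apply: Fs.
Qed.

(** Multiplication by [w] maps [M/W] onto [(A + wM)/A], and preimages under a surjection keep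
    inclusions strict. *)
Lemma chain_preimage A W w n : submodule A ->
  (forall u, W u -> A (w *: u)) ->
  chain_between A (addset A (scaleset w setT)) n -> chain_between W setT n.
Proof.
move=> hA wW [F [hF sF]]; exists (fun i => [set u | F i (w *: u)]).
split=> i ile.
  have [hFi AF _] := hF i ile; split=> //.
    split; first by rewrite /= scaler0; case: hFi.
    move=> c u v /= hu hv; rewrite scalerDr scalerA mulrC -scalerA.
    exact: hFi.2.
  by move=> u /wW/AF.
have [hFi AF _] := hF i (ltnW ile); have [hFi1 AF1 FT] := hF i.+1 ile.
have /proper_setP[Fs [v Fv nFv]] := sF i ile.
apply/proper_setP; split; first by move=> u /Fs.
case: (FT v Fv) => a [_ [Aa [u _ ->] vE]]; exists u => /=.
  have -> : w *: u = v - a by rewrite vE addrC addKr.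
  by apply: submodB => //; apply: AF1.
by move=> Fu; apply: nFv; rewrite vE; apply: submodD => //; apply: AF.
Qed.

(** The kernel of multiplication by [w] from [M] to [(A + wM)/A] lies in [W], so distinct submodules
    above [W] have distinct images. *)
Lemma chain_image A W w n : submodule A ->
  (forall u, A (w *: u) -> W u) ->
  chain_between W setT n -> chain_between A (addset A (scaleset w setT)) n.
Proof.
move=> hA Ww [F [hF sF]]; exists (fun i => addset A (scaleset w (F i))).
split=> i ile.
  have [hFi WF _] := hF i ile; split.
  - by apply: submodule_addset => //; apply: submodule_scaleset.
  - by apply: addset_subl; apply: submodule_scaleset.
  - by apply: addsetS => //; apply: scalesetS.
have [hFi WF _] := hF i (ltnW ile); have [hFi1 _ _] := hF i.+1 ile.
have /proper_setP[Fs [v Fv nFv]] := sF i ile.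
apply/proper_setP; split; first by apply: addsetS => //; apply: scalesetS.
exists (w *: v).
  by apply: addset_subr => //; exists v.
move=> [a [_ [Aa [u Fu ->] vE]]]; apply: nFv; rewrite -(subrK u v).
apply: submodD => //; apply: WF; apply: Ww.
by rewrite scalerBr vE addrK.
Qed.

Definition length_le N b := forall n, chain_between N setT n -> (n <= b)%N.

Lemma length_leS N N' b : N `<=` N' -> length_le N b -> length_le N' b.
Proof. by move=> NN h n cn; apply: h; apply: chain_betweenS cn. Qed.

(** Subadditivity of length along the exact sequence [M/W -> M/A -> M/(A + wM) -> 0], whose first
    map is multiplication by [w]. *)
Lemma length_le_add A W w a b : submodule A ->
  (forall u, W u -> A (w *: u)) ->
  length_le W a -> length_le (addset A (scaleset w setT)) b ->
  length_le A (a + b).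
Proof.
move=> hA wW ha hb n cn.
have hw : submodule (scaleset w [set: M]) by apply: submodule_scaleset.
have hT := submodule_addset hA hw.
have [p [q [npq cp cq]]] := chain_between_split hT (addset_subl hw) cn.
apply: (leq_trans npq); apply: leq_add; last exact: hb.
by apply: ha; apply: chain_preimage cp.
Qed.

Lemma quot_length_exists N b :
  submodule N -> length_le N b -> exists n, quot_length N n.
Proof.
move=> hN hb.
have exP : exists n, `[< chain_between N setT n >].
  by exists 0; apply/asboolP; apply: (@chain_between0 _ _ N).
have ubP n : `[< chain_between N setT n >] -> (n <= b)%N by move=> /asboolP /hb.
case: (ex_maxnP exP ubP) => n /asboolP cn nmax.
exists n; split; first exact/chain_betweenT.
by move=> n' /chain_betweenT cn'; apply: nmax; apply/asboolP.
Qed.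

Lemma quot_length_le N n : quot_length N n -> length_le N n.
Proof. by move=> [_ h] k /chain_betweenT /h. Qed.

Lemma quot_length_antitone N T a b :
  submodule N -> N `<` T -> quot_length N a -> quot_length T b -> (b < a)%N.
Proof.
move=> hN NT [_ hn] [/chain_betweenT [F [hF sF]] _].
(* Putting [N] in front of a longest chain above [T] gains one step. *)
apply: hn; apply/chain_betweenT; exists (fun i => if i is j.+1 then F j else N).
have [NsT [u Tu nNu]] := (proper_setP N T).1 NT.
split=> -[|i] => [_|/hF[? TF _]|_|/sF //]; first by split.
  by split=> //; apply: subset_trans TF.
case: (hF 0 isT) => _ TF _; apply/proper_setP.
by split; [apply: subset_trans TF|exists u => //; apply: TF].
Qed.

End Chains.

(** * Lengths of quotients by powers of a regular sequence *)

Section AdicLength.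
Variables (R : comNzRingType) (M : lmodType R).
Implicit Types (N A B W : set M) (s t : seq R) (w z : R).

Lemma addset0l A : addset [set 0] A = A.
Proof.
apply/seteqP; split=> [_ [_ [a [-> Aa ->]]]|a Aa]; first by rewrite add0r.
by exists 0, a; rewrite add0r.
Qed.

Lemma iter_seqmul_submodule s n W : submodule W -> submodule (iter n (seqmul s) W).
Proof. by move=> hW; elim: n => [//|n IH]; apply: submodule_seqmul. Qed.

Lemma iter_seqmul_anti s n W : submodule W ->
  iter n.+1 (seqmul s) W `<=` iter n (seqmul s) W.
Proof. by move=> hW; apply: seqmul_sub; apply: iter_seqmul_submodule. Qed.

Lemma seqmul_cons_sub w s W : submodule W -> seqmul s W `<=` seqmul (w :: s) W.
Proof. by move=> hW; apply: addset_subr; apply: submodule_scaleset. Qed.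

Lemma iter_seqmul_cons_sub w s n W : submodule W ->
  iter n (seqmul s) W `<=` iter n (seqmul (w :: s)) W.
Proof.
move=> hW; elim: n => [//|n IH]; rewrite !iterS.
have h := @seqmulS _ _ s _ _ IH.
apply: subset_trans h _.
by apply: seqmul_cons_sub; apply: iter_seqmul_submodule.
Qed.

Lemma seqmul_addset s w A B :
  seqmul s (addset A (scaleset w B)) `<=`
  addset (seqmul s A) (scaleset w (seqmul s B)).
Proof.
elim: s => [_ ->|z s IH] /=.
  by exists 0, 0; rewrite addr0; split=> //; exists 0; rewrite ?scaler0.
move=> _ [_ [v [[_ [a [_ [Aa [b Bb ->] ->]]] ->] /IH hv ->]]].
case: hv => a' [_ [Aa' [b' Bb' ->] ->]].
exists (z *: a + a'), (w *: (z *: b + b')); split.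
- by exists (z *: a), a'; split=> //; exists a.
- by exists (z *: b + b') => //; exists (z *: b), b'; split=> //; exists b.
- by rewrite !scalerDr addrACA !scalerA mulrC.
Qed.

(** A product of [n + 1] entries of [w :: s] either avoids [w] or has a factor [w] to split off. *)
Lemma iter_seqmul_cons w s n W : submodule W ->
  iter n.+1 (seqmul (w :: s)) W `<=`
  addset (iter n.+1 (seqmul s) W) (scaleset w (iter n (seqmul (w :: s)) W)).
Proof.
move=> hW; elim: n => [|n IH].
  by move=> _ [x [y [hx hy ->]]]; exists y, x; rewrite addrC.
set X := iter n.+1 (seqmul (w :: s)) W in IH *.
set B := iter n (seqmul (w :: s)) W in IH *.
have hX : submodule X by apply: iter_seqmul_submodule.
move=> _ [_ [v [[x Xx ->] hv ->]]].
have [a [_ [ha [b hb ->] ->]]] := seqmul_addset (seqmulS IH hv).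
exists a, (w *: (b + x)); split=> //; last by rewrite addrCA -scalerDr (addrC x).
exists (b + x) => //; apply: submodD => //.
by apply: seqmul_cons_sub hb; apply: iter_seqmul_submodule.
Qed.

(** * Regular elements modulo powers of an ideal, and the resulting lengths *)

Definition regular_mod N z := forall u : M, N (z *: u) -> N u.

(* A conjunction of conditions [regular_mod (N + (t) M) a], with t a sublist of
   s and a an entry of z :: s. *)
Fixpoint adic_regular N z s : Prop :=
  if s is w :: s' then
    adic_regular (addset (scaleset w setT) N) z s' /\ adic_regular N w s'
  else regular_mod N z.

(** Through [adic_regularP], each entry is regular modulo [N], the multiples of the earlier entries
    and any power of the ideal of the later ones; [adic_length_chain] consumes exactly this. *)
Fixpoint adic_regular_seq N s : Prop :=
  if s is w :: s' then
    adic_regular N w s' /\ adic_regular_seq (addset (scaleset w setT) N) s'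
  else True.

Local Notation pow s n := (iter n (seqmul s) [set: M]).

(** Splitting the multiples of [w] off the decomposition of [w *: u] leaves [w *: (u - v)] in
    [N + (s)^(n+1) M], with [v] in [(w, s)^n M]; there [w] cancels. *)
Lemma adic_colon N w s n u : submodule N ->
  regular_mod (addset N (pow s n.+1)) w ->
  addset N (pow (w :: s) n.+1) (w *: u) -> addset N (pow (w :: s) n) u.
Proof.
move=> hN wreg [a [b [Na hb uE]]].
have [c [_ [hc [v hv ->] bE]]] := iter_seqmul_cons (@submodule_setT _ M) hb.
have hP : submodule (pow (w :: s) n) by apply: iter_seqmul_submodule.
have : addset N (pow s n.+1) (u - v).
  apply: wreg; exists a, c; split=> //.
  by rewrite scalerBr uE bE addrA addrK.
move=> [a' [c' [Na' hc' e]]]; exists a', (c' + v); split=> //; last first.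
  by rewrite addrA -e subrK.
apply: submodD => //; apply: iter_seqmul_cons_sub => //.
exact: iter_seqmul_anti.
Qed.

(* M/(N + (w,s)^(n+1) M) is an extension of M/(N + wM + s^(n+1) M) by
   M/(N + (w,s)^n M), and an element regular on both ends is regular on the
   middle. *)
Lemma adic_regularP N z s n : submodule N ->
  adic_regular N z s -> regular_mod (addset N (pow s n)) z.
Proof.
elim: s N z n => [|w s IHs] N z n hN.
  move=> zreg u; case: n => [_|n].
    by exists 0, u; rewrite add0r; split=> //; case: hN.
  move=> [a [b [Na -> e]]]; exists u, 0; rewrite addr0; split=> //.
  by apply: zreg; rewrite e addr0.
move=> [zreg wreg]; elim: n => [|n IHn] u.
  by move=> _; exists 0, u; rewrite add0r; split=> //; case: hN.
have hN' : submodule (addset (scaleset w setT) N).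
  by apply: submodule_addset => //; apply: submodule_scaleset.
have hP k t : submodule (pow t k) by apply: iter_seqmul_submodule.
move=> hu.
(* The outer induction, modulo [N + wM], cancels [z] up to a multiple [w *: b], the only part of [u]
   left to control. *)
have [v [y [[_ [a [[b _ ->] Na ->]]] hy uE]]] :
    addset (addset (scaleset w setT) N) (pow s n.+1) u.
  apply: (IHs _ z n.+1 hN' zreg).
  apply: addset_min hu; first exact: submodule_addset.
    move=> x Nx; apply: addset_subl => //; apply: addset_subr => //.
    exact: submodule_scaleset.
  move=> x /(iter_seqmul_cons (@submodule_setT _ M))[p [_ [hp [q _ ->] ->]]].
  apply: submodD; first exact: submodule_addset.
    exact: addset_subr.
  by apply: addset_subl => //; apply: addset_subl => //; exists q.
have hA : submodule (addset N (pow (w :: s) n.+1)) by apply: submodule_addset.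
have hay : addset N (pow (w :: s) n.+1) (a + y).
  by exists a, y; split=> //; apply: iter_seqmul_cons_sub.
(* [adic_colon] divides [w *: (z *: b)] by [w] at the cost of one power; the inner induction cancels
   [z] at exponent [n], and multiplying by [w] restores exponent [n + 1]. *)
have hb : addset N (pow (w :: s) n) b.
  apply: IHn; apply: (@adic_colon N w s n _ hN); first exact: IHs.
  have -> : w *: (z *: b) = z *: u - z *: (a + y).
    by rewrite uE -scalerBr -(addrA (w *: b)) addrK !scalerA mulrC.
  by apply: submodB => //; apply: submodZ.
rewrite uE -addrA; apply: submodD => //.
case: hb => p [q [Np hq ->]]; exists (w *: p), (w *: q); split.
- exact: submodZ.
- apply: (@mem_seqmul _ _ (w :: s)) hq; [exact: iter_seqmul_submodule|exact: mem_head].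
- by rewrite scalerDr.
Qed.

(* The coefficient of T^n in the power series (L + E T/(1 - T)) / (1 - T)^d. *)
Fixpoint adic_hilbert (E L d : nat) : nat -> nat :=
  if d is d'.+1 then
    fix h n := if n is n'.+1 then (h n' + adic_hilbert E L d' n)%N else L
  else fun n => if n is 0 then L else E.

(** The recursion of [adic_hilbert] in [n] and [d] is Pascal's rule. *)
Lemma adic_hilbertE E L d n :
  adic_hilbert E L d.+1 n = (E * 'C(n + d, d.+1) + L * 'C(n + d, d))%N.
Proof.
elim: d n => [|d IHd]; elim=> [|n IHn].
- by rewrite /= bin0n bin0 muln0 muln1.
- rewrite /= in IHn *; rewrite IHn !addn0 !bin1 !bin0; lia.
- by rewrite /= add0n bin_small // binn muln0 muln1.
rewrite [LHS]/= -/(adic_hilbert E L d.+2 n) -/(adic_hilbert E L d.+1 n.+1).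
by rewrite IHn IHd !addSn !addnS !binS; lia.
Qed.

(** The head [w] is peeled off: its multiples are bounded by the case of exponent [n], the quotient
    by [wM] by the shorter list. Multiplication by [w] may have a kernel, whence only an upper
    bound. *)
Lemma adic_length_le N W s n E L : submodule N -> submodule W ->
  length_le (addset N (seqmul s setT)) E -> length_le W L ->
  length_le (addset N (iter n (seqmul s) W)) (adic_hilbert E L (size s) n).
Proof.
move=> + hW + hL; have hLN N' : submodule N' -> length_le (addset N' W) L.
  by move=> hN'; apply: length_leS hL; apply: addset_subr.
(* With no generators, exponent 0 leaves [N + W], bounded by [L], and a positive exponent leaves
   [N], bounded by [E]. *)
elim: s n N => [|w s IHs] n N hN hE; first by case: n => [|n]; [apply: hLN|].
elim: n => [|n IHn]; first exact: hLN.
have hw : submodule (scaleset w [set: M]) by apply: submodule_scaleset.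
have hwN := submodule_addset hw hN.
have hA k t : submodule (iter k (seqmul t) W) by apply: iter_seqmul_submodule.
rewrite [adic_hilbert _ _ _ _]/= -/(adic_hilbert E L (size s).+1 n).
apply: (length_le_add (w := w) _ _ IHn).
- by apply: submodule_addset => //; apply: (hA n.+1).
- move=> _ [p [q [Np hq ->]]]; exists (w *: p), (w *: q); split.
  + exact: submodZ.
  + apply: (@mem_seqmul _ _ (w :: s)) hq; [exact: iter_seqmul_submodule|exact: mem_head].
  + by rewrite scalerDr.
apply: (length_leS _ (IHs n.+1 _ hwN _)).
  apply: addset_min.
  - by do 2 apply: submodule_addset => //; apply: (hA n.+1).
  - move=> _ [p [q [hp Nq ->]]]; rewrite addrC.
    exists q, p; split=> //; exact: addset_subl.
  - move=> x hx; apply: addset_subl => //; apply: addset_subr => //.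
    exact: (@iter_seqmul_cons_sub w s n.+1 W hW).
apply: length_leS hE => _ [p [_ [Np [y [z [hy hz ->]]] ->]]].
exists (y + p), z; split=> //; last by rewrite addrCA addrA.
by exists y, p.
Qed.

(** The reverse bound for [W = M], where [L] is 0: by [adic_colon] multiplication by [w] keeps
    chains strict, so the chains of the two pieces can be concatenated. *)
Lemma adic_length_chain N s n E : submodule N -> adic_regular_seq N s ->
  chain_between (addset N (seqmul s setT)) setT E ->
  chain_between (addset N (pow s n)) setT (adic_hilbert E 0 (size s) n).
Proof.
have c0 N' : submodule N' -> chain_between (addset N' [set: M]) setT 0.
  by move=> hN'; apply: (@chain_between0 _ _ _ _ setT).
elim: s n N => [|w s IHs] n N hN; first by case: n => [|n] //; rewrite /= => *; apply: c0.
move=> [wreg sreg] hE; elim: n => [|n IHn]; first exact: c0.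
have hw : submodule (scaleset w [set: M]) by apply: submodule_scaleset.
have hwN := submodule_addset hw hN.
have hA k t : submodule (pow t k) by apply: iter_seqmul_submodule.
rewrite [adic_hilbert _ _ _ _]/= -/(adic_hilbert E 0 (size s).+1 n).
apply: (@chain_between_cat _ _ _
  (addset (addset N (pow (w :: s) n.+1)) (scaleset w setT))).
  apply: chain_image IHn; first exact: submodule_addset.
  by move=> u; apply: adic_colon => //; apply: adic_regularP.
apply: (chain_betweenS _ _ (IHs n.+1 _ hwN sreg _)) => //.
  apply: addset_min.
  - exact: submodule_addset.
  - apply: addset_min; first exact: submodule_addset.
      by move=> x Nx; apply: addset_subl => //; apply: addset_subr.
    move=> x /(iter_seqmul_cons (@submodule_setT _ M))[p [_ [hp [q _ ->] ->]]].
    apply: submodD; [exact: submodule_addset|exact: addset_subr|].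
    by apply: addset_subl => //; apply: addset_subl => //; exists q.
  - by move=> x hx; apply: addset_subl => //; apply: addset_subl.
apply: chain_betweenS hE => // _ [_ [z [[y [p [hy Np ->]]] hz ->]]].
exists p, (y + z); split=> //; last by rewrite addrCA addrA.
by exists y, z.
Qed.

End AdicLength.

(** * Koszul homology *)

Section KoszulComplex.
Variables (R : comNzRingType) (M : lmodType R).
Implicit Types (N : set M) (s t : seq R) (w y : R).

(* The Koszul complex of w :: s is the cone of multiplication by w on that of
   s; all degrees are kept in one module, and [kdeg] singles out a degree. *)
Fixpoint koszul s : lmodType R :=
  if s is _ :: s' then (koszul s' * koszul s')%type else M.

Fixpoint kd s : koszul s -> koszul s :=
  match s return koszul s -> koszul s with
  | [::] => fun=> 0
  | w :: s' => fun z => (kd z.1 + w *: z.2, - kd z.2)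
  end.

Fixpoint kdeg s (i : nat) : set (koszul s) :=
  match s return set (koszul s) with
  | [::] => [set z | i = 0%N \/ z = 0]
  | _ :: s' =>
      [set z | kdeg (s := s') i z.1 /\
               if i is j.+1 then kdeg (s := s') j z.2 else z.2 = 0]
  end.

(** The Koszul complex of the submodule [N] inside that of [M]; working modulo it replaces the
    complex of [M/N]. *)
Fixpoint kmod N s : set (koszul s) :=
  match s return set (koszul s) with
  | [::] => N
  | _ :: s' => [set z | kmod N (s := s') z.1 /\ kmod N (s := s') z.2]
  end.

Fixpoint kinj s (u : M) : koszul s :=
  match s return koszul s with
  | [::] => u
  | _ :: s' => (kinj s' u, 0)
  end.

Lemma kd_linear s a (u v : koszul s) : kd (a *: u + v) = a *: kd u + kd v.
Proof.
elim: s u v => [|w s IH] u v /=; first by rewrite scaler0 addr0.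
congr pair => /=; rewrite !IH; last by rewrite opprD scalerN.
by rewrite !scalerDr addrACA !scalerA mulrC.
Qed.

Lemma kd0 s : kd (0 : koszul s) = 0.
Proof.
have := kd_linear 1 (0 : koszul s) 0; rewrite !scale1r addr0.
by move/(congr1 (fun z => z - kd 0)); rewrite addrK subrr.
Qed.

Lemma kdD s (u v : koszul s) : kd (u + v) = kd u + kd v.
Proof. by have := kd_linear 1 u v; rewrite !scale1r. Qed.

Lemma kdZ s a (u : koszul s) : kd (a *: u) = a *: kd u.
Proof. by rewrite -[a *: u]addr0 kd_linear kd0 !addr0. Qed.

Lemma kdN s (u : koszul s) : kd (- u) = - kd u.
Proof. by rewrite -scaleN1r kdZ scaleN1r. Qed.

Lemma kdB s (u v : koszul s) : kd (u - v) = kd u - kd v.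
Proof. by rewrite kdD kdN. Qed.

Lemma kdK s (z : koszul s) : kd (kd z) = 0.
Proof.
elim: s z => [//|w s IH] z /=; congr pair => /=.
  by rewrite kdD kdZ IH add0r scalerN subrr.
by rewrite kdN IH !oppr0.
Qed.

Lemma kmod_submodule N s : submodule N -> submodule (kmod N (s := s)).
Proof.
move=> hN; elim: s => [//|w s IH]; split; first by split; case: IH.
by move=> a u v [? ?] [? ?]; split; apply: IH.2.
Qed.

Lemma kdeg_submodule s i : submodule (kdeg (s := s) i).
Proof.
elim: s i => [|w s IH] i.
  split; first by right.
  move=> a u v [->|->]; first by left.
  by case=> ->; [left|right; rewrite scaler0 addr0].
split; first by split; [case: (IH i)|case: i => [|i] //; case: (IH i)].
move=> a u v [hu hu'] [hv hv']; split; first exact: (IH i).2.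
case: i hu' hv' {hu hv} => [/= hu hv|i hu hv]; last exact: (IH i).2.
by rewrite /= hu hv scaler0 addr0.
Qed.

Lemma kmod_kd N s (z : koszul s) : submodule N -> kmod N z -> kmod N (kd z).
Proof.
move=> hN; elim: s z => [|w s IH] z /=; first by move=> _; case: hN.
have hK := kmod_submodule s hN.
move=> [z1 z2]; split; last exact: (submodN hK (IH _ z2)).
by apply: (submodD hK (IH _ z1)); apply: submodZ.
Qed.

Lemma kd_kinj s u : kd (kinj s u) = 0.
Proof. by elim: s => [//|w s IH] /=; rewrite IH kd0 scaler0 addr0 oppr0. Qed.

Lemma kdeg0P s (z : koszul s) : kdeg 0 z -> exists u, z = kinj s u.
Proof.
elim: s z => [|w s IH] z /=; first by exists z.
by case: z => a b /= [/IH[u ->] ->]; exists u.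
Qed.

Lemma kdeg_kd s i (z : koszul s) : kdeg i.+1 z -> kdeg i (kd z).
Proof.
elim: s i z => [|w s IH] i z /=; first by right.
move=> [z1 z2]; split.
  exact: (submodD (kdeg_submodule s i) (IH _ _ z1) (submodZ _ (kdeg_submodule s i) z2)).
case: i z1 z2 => [|i] z1 z2; last exact: (submodN (kdeg_submodule s i) (IH _ _ z2)).
by have [u ->] := kdeg0P z2; rewrite kd_kinj oppr0.
Qed.

Lemma kdeg_gt_size s i (z : koszul s) : (size s < i)%N -> kdeg i z -> z = 0.
Proof.
elim: s i z => [|w s IH] [|i] //=; first by move=> z _ [].
move=> [a b] si /= [ha hb].
have -> : a = 0 by apply: (IH i.+1) => //; apply: leqW.
by have -> : b = 0 by apply: (IH i).
Qed.

Lemma kinj_linear s a (u v : M) : kinj s (a *: u + v) = a *: kinj s u + kinj s v.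
Proof.
elim: s => [//|w s IH] /=; rewrite IH.
by congr pair; rewrite /= scaler0 addr0.
Qed.

Lemma kinj0 s : kinj s 0 = 0.
Proof. by elim: s => [//|w s IH] /=; rewrite IH. Qed.

Lemma kinjZ s a (u : M) : kinj s (a *: u) = a *: kinj s u.
Proof. by rewrite -[a *: u]addr0 kinj_linear kinj0 addr0. Qed.

Lemma kinj_inj s : injective (kinj s).
Proof. by elim: s => [//|w s IH] u v /= [/IH]. Qed.

Lemma kdeg_kinj s u : kdeg 0 (kinj s u).
Proof. by elim: s => [|w s IH] /=; [left|]. Qed.

(** Together with [kd_deg1], this identifies the boundaries in degree 0 with [(s) M]. *)
Lemma kd_onto s u : seqmul s setT u -> exists2 a : koszul s, kdeg 1 a & kd a = kinj s u.
Proof.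
elim: s u => [|w s IH] u /=; first by move=> ->; exists 0; [right|].
move=> [_ [v [[x _ ->] /IH[a ha ae] ->]]]; exists (a, kinj s x) => /=.
  by split=> //; apply: kdeg_kinj.
by rewrite ae kd_kinj oppr0 kinj_linear addrC.
Qed.

Lemma kd_deg1 s (a : koszul s) : kdeg 1 a -> exists2 u, seqmul s setT u & kd a = kinj s u.
Proof.
elim: s a => [|w s IH] a /=; first by exists 0.
case: a => a b /= [/IH[u hu ->] /kdeg0P[x ->]].
exists (w *: x + u); first by exists (w *: x), u; split=> //; exists x.
by rewrite kd_kinj oppr0 kinj_linear addrC.
Qed.

(** A null-homotopy of multiplication by [y]. Preserving every [kmod N] lets it descend to each
    quotient [M/N]. *)
Definition koszul_homotopy s y (h : koszul s -> koszul s) : Prop :=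
  [/\ forall a u v, h (a *: u + v) = a *: h u + h v,
      forall i z, kdeg i z -> kdeg i.+1 (h z),
      forall N z, submodule N -> kmod N z -> kmod N (h z) &
      forall z, kd (h z) + h (kd z) = y *: z].

Lemma koszul_homotopy_gen s y : y \in s -> exists h, @koszul_homotopy s y h.
Proof.
elim: s => [//|w s IH]; rewrite inE => /predU1P[->|/IH[h [hl hd hm hh]]].
  (* For the head of the list, the homotopy moves the first copy in the cone to the shifted second
     one. *)
  exists (fun z => (0, z.1)); split.
  - by move=> a u v; congr pair; rewrite /= scaler0 addr0.
  - by move=> i z [? ?]; split=> //; case: (kdeg_submodule s i.+1).
  - by move=> N z hN [? ?]; split=> //; case: (kmod_submodule s hN).
  move=> [a b] /=; congr pair => /=; first by rewrite kd0 add0r addr0.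
  by rewrite addrA addNr add0r.
have h0 : h 0 = 0.
  have := hl 1 0 0; rewrite !scale1r addr0.
  by move/(congr1 (fun z => z - h 0)); rewrite addrK subrr.
(* For a later entry, the sign makes the cross terms in [w] cancel. *)
exists (fun z => (h z.1, - h z.2)); split.
- by move=> a u v; congr pair; rewrite /= hl // opprD scalerN.
- move=> i [a b] [/= ha hb]; split; first exact: hd.
  case: i ha hb => [|i] _ hb /=.
    by rewrite hb h0 oppr0; case: (kdeg_submodule s 0).
  by apply: (submodN (kdeg_submodule s i.+1)); apply: hd.
- move=> N [a b] hN [/= ha hb]; split; first exact: hm.
  by apply: (submodN (kmod_submodule s hN)); apply: hm.
move=> [a b] /=; congr pair => /=.
  by rewrite [_ + w *: b]addrC hl scalerN -addrA addKr hh.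
have hN u : h (- u) = - h u by rewrite -scaleN1r -[_ *: u]addr0 hl h0 addr0 scaleN1r.
by rewrite kdN hN !opprK hh.
Qed.

(** Homotopies combine linearly, so the elements admitting one form an ideal. *)
Lemma koszul_homotopy_ideal s y :
  ideal_gen [set` s] y -> exists h, @koszul_homotopy s y h.
Proof.
move: y; suff h : ideal_gen [set` s] `<=` [set y | exists h, @koszul_homotopy s y h].
  exact: h.
apply: ideal_gen_min => [|y]; last exact: koszul_homotopy_gen.
split.
  exists (fun=> 0); split.
  - by move=> *; rewrite scaler0 addr0.
  - by move=> i z _; case: (kdeg_submodule s i.+1).
  - by move=> N z hN _; case: (kmod_submodule s hN).
  - by move=> z; rewrite kd0 scale0r addr0.
move=> c y y' [h [hl hd hm hh]] [h' [hl' hd' hm' hh']].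
exists (fun z => c *: h z + h' z); split.
- move=> a u v; rewrite hl hl' !scalerDr addrACA; congr (_ + _ + _).
  by rewrite !scalerA mulrC.
- by move=> i z hz; apply: (kdeg_submodule s i.+1).2; [apply: hd|apply: hd'].
- by move=> N z hN hz; apply: (kmod_submodule s hN).2; [apply: hm|apply: hm'].
- by move=> z; rewrite kd_linear addrACA -scalerDr hh hh' scalerDl scalerA.
Qed.

Lemma kmodS N N' s (z : koszul s) : N `<=` N' -> kmod N z -> kmod N' z.
Proof. by move=> NN'; elim: s z => [|w s IH] z /=; [apply: NN'|move=> [/IH ? /IH ?]]. Qed.

Lemma kmod_scale N s y (z : koszul s) :
  submodule N -> kmod (addset (scaleset y setT) N) (y *: z).
Proof.
move=> hN; elim: s z => [|w s IH] z /=; last by split; apply: IH.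
by apply: addset_subl => //; exists z.
Qed.

Lemma kmod_regular N s y (z : koszul s) :
  regular_mod N y -> kmod N (y *: z) -> kmod N z.
Proof.
move=> yreg; elim: s z => [|w s IH] z /=; first exact: yreg.
by move=> [/IH ? /IH ?].
Qed.

Lemma kmod_addset N s y i (z : koszul s) : submodule N ->
  kmod (addset (scaleset y setT) N) z -> kdeg i z ->
  exists2 c, kdeg i c & kmod N (z - y *: c).
Proof.
move=> hN; elim: s i z => [|w s IH] i z /=.
  move=> [_ [n [[c _ ->] Nn ->]]] [->|->].
    by exists c; [left|rewrite addrC addKr].
  by exists 0; [right|rewrite scaler0 subr0; case: hN].
case: z => a b /= [/IH ha /IH hb] [/ha[c hc hc'] hbi].
case: i hc hbi {ha} => [|i] hc; last by move=> /hb[e he he']; exists (c, e).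
move=> /= b0; exists (c, 0); split=> //=.
by rewrite b0 scaler0 subr0; case: (kmod_submodule s hN).
Qed.

(* Vanishing of the i-th Koszul homology of s on M/N *)
Definition koszul_exact N s i := forall z : koszul s,
  kdeg i z -> kmod N (kd z) -> exists2 a, kdeg i.+1 a & kmod N (z - kd a).

(* Some power of y annihilates the homology modulo N, and y is injective on
   H_i(M/N) as soon as H_(i+1)(M/(N + yM)) = 0. *)
Lemma koszul_exact_regular N s y n i : submodule N ->
  regular_mod N y -> ideal_gen [set` s] (y ^+ n) ->
  koszul_exact (addset (scaleset y setT) N) s i.+1 -> koszul_exact N s i.
Proof.
move=> hN yreg /koszul_homotopy_ideal[h [hl hd hm hh]] hex z hz Nz.
have hK := kmod_submodule s hN.
have : exists2 a, kdeg i.+1 a & kmod N (y ^+ n *: z - kd a).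
  exists (h z); first exact: hd.
  by rewrite -hh addrC addKr; apply: hm.
elim: n {hh} => [|n IH]; first by rewrite expr0 scale1r.
move=> [a ha hza]; apply: IH.
(* The boundary of [a] is a multiple of [y] modulo [N], so [a] is a cycle modulo [N + yM], hence a
   boundary there. Subtracting that boundary leaves some [y *: c], and [c] replaces [a] once one
   factor [y] is cancelled. *)
have [|b hb hab] := hex a ha.
  have hN' : submodule (addset (scaleset y setT) N).
    by apply: submodule_addset => //; apply: submodule_scaleset.
  rewrite -[kd a](subKr (y ^+ n.+1 *: z)); apply: submodB.
  - exact: kmod_submodule.
  - by rewrite exprS -scalerA; apply: kmod_scale.
  - by apply: kmodS hza; apply: addset_subr; apply: submodule_scaleset.
have [c hc hcn] := kmod_addset hN hab (submodB (kdeg_submodule s i.+1) ha (kdeg_kd hb)).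
exists c => //; apply: (kmod_regular yreg).
have -> : y *: (y ^+ n *: z - kd c) =
    (y ^+ n.+1 *: z - kd a) + kd (a - kd b - y *: c).
  by rewrite !kdB kdK subr0 kdZ addrA subrK scalerBr scalerA -exprS.
by apply: submodD => //; apply: kmod_kd.
Qed.

Lemma seqmul_eq_mem s t (W : set M) :
  submodule W -> s =i t -> seqmul s W = seqmul t W.
Proof.
move=> hW st; rewrite -!smul_gen //; congr (smul (ideal_gen _) _).
by apply/seteqP; split=> a /=; rewrite st.
Qed.

(** Induction on the number of entries of [ys] not yet divided out. Modulo all of them, degrees
    above [size s] vanish trivially; giving back one entry extends the vanishing one degree down. *)
Lemma koszul_exact_regular_sequence s ys i :
  regular_sequence M ys ->
  (forall y, y \in ys -> exists n, ideal_gen [set` s] (y ^+ n)) ->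
  (size s < i + size ys)%N -> koszul_exact [set 0] s i.
Proof.
move=> [yreg _] ypow.
suff h j k i' : size ys = (j + k)%N -> (size s < i' + k)%N ->
    koszul_exact (seqmul (take j ys) setT) s i'.
  by move=> si; have := h 0 (size ys) i; rewrite take0; apply.
elim: k j i' => [|k IH] j i' jk sik z hz Nz.
  exists 0; first by case: (kdeg_submodule s i'.+1).
  have z0 : z = 0 by apply: kdeg_gt_size hz; rewrite -[i']addn0.
  rewrite z0 kd0 subr0.
  by case: (kmod_submodule s (submodule_seqmul (take j ys) (@submodule_setT _ M))).
have jlt : (j < size ys)%N by rewrite jk addnS ltnS leq_addr.
have [n hn] := ypow _ (mem_nth 0 jlt).
have hN := submodule_seqmul (take j ys) (@submodule_setT _ M).
apply: (koszul_exact_regular hN _ hn _ hz Nz).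
  by move=> u; have := yreg j jlt u; rewrite smul_gen.
have -> : addset (scaleset ys`_j setT) (seqmul (take j ys) [set: M]) =
    seqmul (take j.+1 ys) setT.
  rewrite (take_nth 0 jlt).
  apply: (@seqmul_eq_mem (ys`_j :: take j ys) _ setT) => // a.
  by rewrite mem_rcons.
by apply: IH; [rewrite jk addSnnS|rewrite addSnnS].
Qed.

End KoszulComplex.

(** * Noetherian modules and Nakayama's lemma *)

Definition noetherian_module (R : comNzRingType) (M : lmodType R) : Prop :=
  forall N : set M, submodule N -> exists s : seq M, N = Defs.span [set` s].

Section SpanSeq.
Variables (R : comNzRingType) (M : lmodType R).
Implicit Types (N : set M) (s t : seq M).

Lemma span_cons a s : Defs.span [set` a :: s] `<=`
  [set u | exists c (t : M), Defs.span [set` s] t /\ u = c *: a + t].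
Proof.
have hs := span_submodule [set` s]; apply: span_min => [|u /=].
  split; first by exists 0, 0; split; [case: hs|rewrite scale0r addr0].
  move=> c _ _ [p [t [ht ->]]] [q [t' [ht' ->]]].
  exists (c * p + q), (c *: t + t'); split; first exact: hs.2.
  by rewrite scalerDr scalerDl scalerA addrACA.
rewrite inE => /predU1P[->|us].
  by exists 1, 0; split; [case: hs|rewrite scale1r addr0].
by exists 0, u; split; [exact: sub_span|rewrite scale0r add0r].
Qed.

Lemma span_nil : Defs.span [set` ([::] : seq M)] = [set 0].
Proof.
apply/seteqP; split; first by apply: span_min => //; apply: submodule_set0.
by move=> _ ->; case: (span_submodule [set` ([::] : seq M)]).
Qed.

Lemma span_subset s t : {subset s <= t} ->
  Defs.span [set` s] `<=` Defs.span [set` t].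
Proof.
move=> st; apply: span_min; first exact: span_submodule.
by move=> u /st ut; apply: sub_span.
Qed.

Lemma submodule_preimage (V : lmodType R) (f : V -> M) N :
  linear f -> submodule N -> submodule (f @^-1` N).
Proof.
move=> lf hN; split; last by move=> c u v /= hu hv; rewrite lf; apply: hN.2.
suff e : f 0 = 0 by rewrite /= e; case: hN.
by have := lf (-1) 0 0; rewrite scaler0 addr0 scaleN1r addNr.
Qed.

Lemma submodule_image (V : lmodType R) (f : V -> M) (N : set V) :
  linear f -> submodule N -> submodule (f @` N).
Proof.
move=> lf hN; split.
  exists 0; first by case: hN.
  by have := lf (-1) 0 0; rewrite scaler0 addr0 scaleN1r addNr.
move=> c _ _ [u Nu <-] [v Nv <-]; exists (c *: u + v); first exact: hN.2.
by rewrite lf.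
Qed.

Lemma span_map (V : lmodType R) (f : V -> M) (s : seq V) :
  linear f -> f @` Defs.span [set` s] = Defs.span [set` map f s].
Proof.
move=> lf; apply/seteqP; split.
  move=> _ [v + <-]; move: v.
  suff h : Defs.span [set` s] `<=` f @^-1` Defs.span [set` map f s] by exact: h.
  apply: span_min; first exact: submodule_preimage (span_submodule _).
  by move=> v /= vs; apply: sub_span; rewrite /= map_f.
apply: span_min; first exact: submodule_image (span_submodule _).
by move=> _ /= /mapP[v vs ->]; exists v => //; apply: sub_span.
Qed.

Lemma noetherian_module_image (V : lmodType R) (f : V -> M) :
  linear f -> f @` setT = setT -> noetherian_module V -> noetherian_module M.
Proof.
move=> lf fT hV N hN; have [s es] := hV _ (submodule_preimage lf hN).
exists (map f s); rewrite -span_map // -es; apply/seteqP; split=> [u Nu|_ [v ? <-] //].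
have : (f @` setT) u by rewrite fT.
by move=> [v _ e]; exists v => //=; rewrite e.
Qed.

End SpanSeq.

(** A submodule is generated by lifts of generators of its projection to [U] together with
    generators of its intersection with [V]. *)
Lemma noetherian_module_prod (R : comNzRingType) (U V : lmodType R) :
  noetherian_module U -> noetherian_module V -> noetherian_module (U * V)%type.
Proof.
move=> hU hV N hN.
have lfst : linear (fst : (U * V)%type -> U) by [].
have lsnd : linear (fun v : V => (0, v) : (U * V)%type).
  by move=> c u v; congr pair; rewrite /= scaler0 addr0.
have [s es] := hU _ (submodule_image lfst hN).
have [t et] := hV _ (submodule_preimage lsnd hN).
have [r rN er] : exists2 r : seq (U * V)%type, {subset r <= N} & map fst r = s.
  have : {subset s <= fst @` N} by move=> u us; rewrite inE es; apply: sub_span.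
  elim: s {es} => [|u s IH] hs; first by exists [::].
  have [|r rN er] := IH; first by move=> v vs; apply: hs; rewrite inE vs orbT.
  have := hs u (mem_head _ _); rewrite inE => -[z Nz zu].
  exists (z :: r); last by rewrite /= er zu.
  by move=> y; rewrite inE => /predU1P[->|/rN //]; rewrite inE.
pose g := map (fun v : V => (0, v) : (U * V)%type) t.
have gN : {subset g <= N}.
  move=> _ /mapP[v vt ->]; rewrite inE.
  suff : ((fun v : V => (0, v) : (U * V)%type) @^-1` N) v by [].
  by rewrite et; apply: sub_span.
exists (r ++ g); apply/seteqP; split; last first.
  apply: span_min => // z /=; rewrite mem_cat => /orP[/rN|/gN]; by rewrite inE.
move=> z Nz; have hs := span_submodule [set` r ++ g].
have : (fst @` N) z.1 by exists z.
rewrite es -er -span_map // => -[y hy ey].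
have hyN : N y.
  by apply: span_min hy => // v /rN; rewrite inE.
have : ((fun v : V => (0, v) : (U * V)%type) @^-1` N) (z.2 - y.2).
  suff e : z - y = (0, z.2 - y.2) by rewrite /preimage /= -e; apply: submodB.
  by rewrite [z - y]surjective_pairing /= ey subrr.
rewrite et => ht.
have hz : z = (0, z.2 - y.2) + y.
  rewrite [LHS]surjective_pairing [y in RHS]surjective_pairing.
  by congr pair; rewrite /= ?add0r ?ey // subrK.
rewrite hz; apply: (submodD hs); last first.
  have rg : {subset r <= r ++ g} by move=> v vr; rewrite mem_cat vr.
  exact: (span_subset rg hy).
have gg : {subset g <= r ++ g} by move=> v vg; rewrite mem_cat vg orbT.
by apply: (span_subset gg); rewrite -span_map //; exists (z.2 - y.2).
Qed.

(** [M] is an image of a finite power of [R], built one generator at a time; a factor [R^o] with the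
    zero map starts the recursion. *)
Lemma noetherian_module_fg (R : comNzRingType) (M : lmodType R) :
  noetherian R -> finitely_generated M -> noetherian_module M.
Proof.
move=> hR [s es].
have [V [f [hV lf fs]]] : exists (V : lmodType R) (f : V -> M),
    [/\ noetherian_module V, linear f & f @` setT = Defs.span [set` s]].
  elim: s {es} => [|a s [V [f [hV lf fs]]]].
    exists R^o, (fun=> 0); split; first exact: hR.
      by move=> c u v; rewrite scaler0 addr0.
    rewrite span_nil; apply/seteqP; split=> [_ [_ _ <-] //|_ ->].
    by exists 0.
  exists (R^o * V)%type, (fun z => z.1 *: a + f z.2); split.
  - by apply: noetherian_module_prod => //; exact: hR.
  - move=> c u v /=; rewrite lf scalerDr addrACA; congr (_ + _).
    by rewrite scalerDl scalerA.
  apply/seteqP; split=> [_ [z _ <-]|u /span_cons[c [t [+ ->]]]].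
    have hs := span_submodule [set` a :: s].
    apply: (submodD hs).
      apply: (submodZ _ hs).
      by apply: sub_span; rewrite /= mem_head.
    apply: (@span_subset _ _ s) => [v vs|]; first by rewrite inE vs orbT.
    by rewrite -fs; exists z.2.
  by rewrite -fs => -[v _ <-]; exists (c, v).
by apply: noetherian_module_image lf _ hV; rewrite fs es.
Qed.

Lemma noetherian_koszul (R : comNzRingType) (M : lmodType R) (s : seq R) :
  noetherian_module M -> noetherian_module (koszul M s).
Proof. by move=> hM; elim: s => [//|w s IH]; apply: noetherian_module_prod. Qed.

Lemma maximal_ideal_exists (R : comNzRingType) (J : set R) :
  ideal J -> ~ J 1 -> exists2 m, maximal_ideal m & J `<=` m.
Proof.
move=> hJ J1; pose P A := A = set0 \/ [/\ ideal A, J `<=` A & ~ A 1].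
have PJ : P J by right; split.
have [F FP Ftot|m [Pm mmax]] := @Zorn_bigcup R P.
  have [[A FA [a Aa]]|F0] := pselect (exists2 A, F A & exists a, A a); last first.
    left; apply/seteqP; split=> // a [A FA Aa]; apply: F0.
    by exists A => //; exists a.
  have FI B b : F B -> B b -> [/\ ideal B, J `<=` B & ~ B 1].
    by move=> /FP[->|//].
  right; split.
  - split; first by exists A => //; case: (FI _ _ FA Aa) => -[].
    move=> c u v [B FB Bu] [C FC Cv].
    have [BC|CB] := Ftot B C FB FC.
      by exists C => //; case: (FI _ _ FC Cv) => hC _ _; apply: hC.2 => //; apply: BC.
    by exists B => //; case: (FI _ _ FB Bu) => hB _ _; apply: hB.2 => //; apply: CB.
  - by move=> u Ju; exists A => //; case: (FI _ _ FA Aa) => _ + _; apply.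
  - by move=> [B FB B1]; case: (FI _ _ FB B1).
case: Pm => [m0|[hm Jm m1]].
  exfalso; apply: (mmax J) => //; rewrite m0; split=> // /(_ 0); apply.
  by case: hJ.
exists m => //; split=> //; first by move=> mT; apply: m1; rewrite mT.
move=> A hA mA; have [A1|A1] := pselect (A 1).
  right; apply/seteqP; split=> // a _; rewrite -[a]mulr1 -[a * 1]addr0.
  by apply: hA.2 => //; case: hA.
left; apply: contrapT => nAm; apply: (mmax A).
  split=> // Am; apply: nAm; exact/seteqP.
by right; split=> //; apply: subset_trans mA.
Qed.

Lemma local_ring_unit (R : comNzRingType) (m : set R) (a : R) :
  local_ring m -> ~ m a -> exists b, b * a = 1.
Proof.
move=> [_ muniq] ma; apply: contrapT => na.
have hJ : ideal [set r | exists b, r = b * a].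
  split; first by exists 0; rewrite mul0r.
  move=> c _ _ [p ->] [q ->]; exists (c * p + q).
  by rewrite mulrDl -mulrA.
have [|p /muniq -> am] := maximal_ideal_exists hJ.
  by move=> [b e]; apply: na; exists b.
by apply: ma; apply: am; exists 1; rewrite mul1r.
Qed.

(** Generators of [Z] are removed one at a time: modulo [B], [a] is [w] times an element with some
    [a]-coefficient [c], so [(1 - w * c) *: a] lies in [B] plus the span of the others, and
    [1 - w * c] is a unit. *)
Lemma nakayama (R : comNzRingType) (m : set R) (M : lmodType R) (Z B : set M) w :
  local_ring m -> m w -> noetherian_module M -> submodule Z -> submodule B ->
  (forall z, Z z -> exists2 z', Z z' & B (z - w *: z')) -> Z `<=` B.
Proof.
move=> hm mw hM hZ hB ZB.
have [s es] := hM Z hZ.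
have : Z `<=` addset B (Defs.span [set` s]) by rewrite -es; apply: addset_subr.
have : {subset s <= Z} by move=> u us; rewrite inE es; apply: sub_span.
elim: s {es} => [_ h u /h|a s IH sZ h].
  by rewrite span_nil => -[b [_ [Bb -> ->]]]; rewrite addr0.
apply: IH; first by move=> u us; apply: sZ; rewrite inE us orbT.
have hs := span_submodule [set` s]; have hBs := submodule_addset hB hs.
suff ha : addset B (Defs.span [set` s]) a.
  move=> u /h[b [_ [Bb /span_cons[c [t [ht ->]]] ->]]].
  apply: submodD => //; first exact: addset_subl.
  by apply: submodD => //; [exact: submodZ|exact: addset_subr].
have Za : Z a by have := sZ a (mem_head _ _); rewrite inE.
have [z Zz Bz] := ZB a Za.
have [b [_ [Bb /span_cons[c [t [ht ->]]] zE]]] := h z Zz.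
have [|p pE] := @local_ring_unit _ m (1 - w * c) hm.
  case: hm => -[[m0 mD] mT _] _ m1; apply: mT; apply/seteqP; split=> // r _.
  have m1' : m 1.
    have -> : (1 : R^o) = c *: (w : R^o) + (1 - w * c).
      by rewrite [c *: _]mulrC addrC subrK.
    exact: mD.
  by rewrite -[r]mulr1 -[r * 1]addr0; apply: mD.
rewrite -[a]scale1r -pE -scalerA; apply: submodZ => //.
have -> : (1 - w * c) *: a = (a - w *: z) + (w *: b + w *: t).
  have -> : w *: b + w *: t = w *: z - (w * c) *: a.
    by rewrite zE !scalerDr scalerA addrCA [RHS]addrC addKr.
  by rewrite addrA subrK scalerBl scale1r.
apply: submodD => //; first exact: addset_subl.
by exists (w *: b), (w *: t); split=> //; [apply: (submodZ _ hB)|apply: (submodZ _ hs)].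
Qed.

(** * From Koszul acyclicity to regularity *)

Section KoszulAcyclic.
Variables (R : comNzRingType) (m : set R) (M : lmodType R).
Hypotheses (hm : local_ring m) (hM : noetherian_module M).
Implicit Types (s t : seq R) (w : R).

Definition koszul_acyclic s := forall i, koszul_exact [set (0 : M)] s i.+1.

Lemma kmod0 s (z : koszul M s) : kmod [set 0] z <-> z = 0.
Proof.
elim: s z => [//|w s IH] [a b] /=; split=> [[/IH -> /IH ->] //|[-> ->]].
by split; apply/IH.
Qed.

Lemma koszul_acyclicP s i (z : koszul M s) : koszul_acyclic s ->
  kdeg i.+1 z -> kd z = 0 -> exists2 a, kdeg i.+2 a & z = kd a.
Proof.
move=> ac hz /kmod0 z0; have [a ha /kmod0 e] := ac i z hz z0.
by exists a => //; apply/eqP; rewrite -subr_eq0 e.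
Qed.

(* The long exact sequence of the cone makes w surjective on the homology of s
   in positive degrees. *)
Lemma koszul_acyclic_cons w s : m w -> koszul_acyclic (w :: s) -> koszul_acyclic s.
Proof.
move=> mw ac i z hz /kmod0 z0.
pose Z := [set u : koszul M s | kdeg i.+1 u /\ kd u = 0].
pose B := [set u : koszul M s | exists2 a, kdeg i.+2 a & u = kd a].
suff ZB : Z `<=` B.
  by have [//|a ha ->] := ZB z; exists a => //; apply/kmod0; rewrite subrr.
have hd k := @kdeg_submodule R M s k.
have hZ : submodule Z.
  split; first by split; [case: (hd i.+1)|apply: kd0].
  move=> c u v [hu u0] [hv v0]; split; first exact: (hd i.+1).2.
  by rewrite kd_linear u0 v0 scaler0 addr0.
have hB : submodule B.
  split; first by exists 0; [case: (hd i.+2)|rewrite kd0].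
  move=> c _ _ [a ha ->] [b hb ->]; exists (c *: a + b); first exact: (hd i.+2).2.
  by rewrite kd_linear.
apply: (nakayama hm mw (noetherian_koszul (s := s) hM) hZ hB) => u [hu u0].
(* [(u, 0)] is a cycle of the cone; writing it as the boundary of [(a, b)] gives [u = kd a + w *: b]
   with [b] again a cycle. *)
have [|/=|[a b] /= [ha hb] [uE bE]] := @koszul_acyclicP (w :: s) i (u, 0) ac.
- by split=> //=; case: (hd i).
- by rewrite u0 kd0 scaler0 addr0 oppr0.
exists b; last by exists a => //; rewrite uE addrK.
by split=> //; apply/eqP; rewrite -oppr_eq0 -bE.
Qed.

(** If [w *: u] is the boundary of [a], then [- a] and [u] form a cycle of degree 1 in the cone;
    being a boundary, it exhibits [u] as an element of [(s) M]. *)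
Lemma koszul_acyclic_regular w s :
  koszul_acyclic (w :: s) -> regular_mod (seqmul s [set: M]) w.
Proof.
move=> ac u /kd_onto[a ha aE].
have [|/=|[p q] /= [_ hq] [_ qE]] := @koszul_acyclicP (w :: s) 0 (- a, kinj s u) ac.
- split=> /=; last exact: kdeg_kinj.
  exact: (@submodN _ _ _ _ (@kdeg_submodule _ M s 1) ha).
- rewrite kdN aE kd_kinj oppr0; congr pair.
  by rewrite kinjZ addNr.
have [v hv vE] := kd_deg1 hq.
have -> : u = - v.
  apply: (@kinj_inj _ _ s); rewrite qE vE.
  by rewrite -[in RHS]scaleN1r kinjZ scaleN1r.
by apply: submodN => //; apply: submodule_seqmul.
Qed.

(* Every sublist of s, in any order, is a regular sequence. *)
Definition all_regular s := forall a t u,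
  perm_eq s (a :: t ++ u) -> regular_mod (seqmul t [set: M]) a.

Lemma all_regular_of_depth s ys :
  regular_sequence M ys -> size ys = size s -> {subset s <= m} ->
  (forall y, y \in ys -> exists n, ideal_gen [set` s] (y ^+ n)) ->
  all_regular s.
Proof.
move=> hys sz sm ypow a t u pstu; apply: koszul_acyclic_regular.
(* The vanishing criterion sees only the ideal and the number of entries, so the list may be
   reordered; [u] goes first in order to be stripped from the head. *)
have ac : koszul_acyclic (u ++ a :: t).
  have ps : perm_eq s (u ++ a :: t) by rewrite (permPl pstu) -cat_cons perm_catC.
  move=> i; apply: (koszul_exact_regular_sequence hys).
    move=> y /ypow[n hn]; exists n.
    suff <- : [set` s] = [set` u ++ a :: t] by [].
    by apply/seteqP; split=> b /=; rewrite (perm_mem ps).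
  by rewrite sz (perm_size ps) addSn ltnS leq_addl.
have um : {subset u <= m}.
  by move=> b bu; apply: sm; rewrite (perm_mem pstu) inE mem_cat bu !orbT.
elim: u um ac {pstu} => [//|b u IH] um ac; apply: IH.
  by move=> c cu; apply: um; rewrite inE cu orbT.
apply: koszul_acyclic_cons ac.
by have := um b (mem_head _ _); rewrite inE.
Qed.

(** [t] holds the entries already divided out and [u] those set aside; the two branches of
    [adic_regular] move [w] to [t] or [z] to [u]. *)
Lemma all_regular_adic x z s t u : all_regular x ->
  perm_eq x (z :: s ++ t ++ u) -> adic_regular (seqmul t [set: M]) z s.
Proof.
move=> hx; elim: s z t u => [|w s IH] z t u px /=; first exact: (hx z t u px).
split.
  apply: (IH z (w :: t) u); apply: (perm_trans px); apply/permP => p.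
  by rewrite /= !count_cat /= !count_cat; lia.
apply: (IH w t (z :: u)); apply: (perm_trans px); apply/permP => p.
by rewrite /= !count_cat /=; lia.
Qed.

Lemma all_regular_adic_seq x s t : all_regular x ->
  perm_eq x (s ++ t) -> adic_regular_seq (seqmul t [set: M]) s.
Proof.
move=> hx; elim: s t => [//|w s IH] t px /=; split.
  by apply: (@all_regular_adic x w s t [::]); rewrite ?cats0.
apply: (IH (w :: t)); apply: (perm_trans px); apply/permP => p.
by rewrite /= !count_cat /=; lia.
Qed.

End KoszulAcyclic.

(** * Hilbert coefficients *)

Section BinomialBasis.
Implicit Types (d n r k : nat) (c : nat -> int).

Lemma bin_add_mono n j j' : (j <= j')%N -> ('C(n + j, j) <= 'C(n + j', j'))%N.
Proof.
move=> jj; rewrite -(bin_sub (leq_addl n j)) -(bin_sub (leq_addl n j')) !addnK.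
by apply: leq_bin2l; rewrite leq_add2l.
Qed.

(** A negative leading coefficient would dominate, since ['C(n + d + 1, d + 1)] outgrows every
    constant multiple of ['C(n + d, d)]. *)
Lemma coef_ge0 d c k0 :
  (forall k, (k0 <= k)%N ->
     0 <= \sum_(i < d.+1) c i * ('C(k + d - i - 1, d - i))%:Z) ->
  0 <= c 0%N.
Proof.
case: d => [|d] h.
  by have := h k0 (leqnn _); rewrite big_ord1 /= bin0 mulr1.
rewrite leNgt; apply/negP => c0.
pose C : int := \sum_(i < d.+1) `|c i.+1|.
have C0 : 0 <= C by apply: sumr_ge0.
(* The two binomials have ratio [(n + d + 1) / (d + 1)], which this choice makes larger than [C]. *)
pose n := (k0 + d.+1 * `|C|)%N.
have := h n.+1 (leqW (leq_addr _ _)); rewrite big_ord_recl /=.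
have -> : (n.+1 + d.+1 - 0 - 1 = n + d.+1)%N by lia.
rewrite subn0 => hsum.
have le1 : \sum_(i < d.+1) c (bump 0 i) *
      ('C(n.+1 + d.+1 - bump 0 i - 1, d.+1 - bump 0 i))%:Z
    <= C * ('C(n + d, d))%:Z.
  rewrite /C mulr_suml; apply: ler_sum => i _; rewrite /bump /= add1n.
  have -> : (n.+1 + d.+1 - i.+1 - 1 = n + (d - i))%N by have := ltn_ord i; lia.
  rewrite subSS; apply: (@le_trans _ _ (`|c i.+1| * ('C(n + (d - i), d - i))%:Z)).
    by apply: ler_wpM2r; rewrite ?lez_nat ?ler_norm.
  apply: ler_wpM2l => //; rewrite lez_nat.
  by apply: bin_add_mono; apply: leq_subr.
have pos : (0 < 'C(n + d, d))%N by rewrite bin_gt0 leq_addl.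
have := mul_bin_diag (n + d.+1) d; rewrite addnS /= => diag.
have c1 : c 0%N * ('C((n + d).+1, d.+1))%:Z <= - ('C((n + d).+1, d.+1))%:Z.
  rewrite -mulN1r; apply: ler_wpM2r; first by rewrite lez_nat.
  by rewrite -ltzD1 addNr.
rewrite addnS in hsum.
have {hsum le1 c1} : ('C((n + d).+1, d.+1) <= `|C| * 'C(n + d, d))%N.
  rewrite -lez_nat PoszM gez0_abs // -subr_ge0.
  apply: (le_trans hsum); rewrite addrC; exact: lerD.
move=> hle; have : ((n + d).+1 * 'C(n + d, d) <= d.+1 * `|C| * 'C(n + d, d))%N.
  by rewrite diag -mulnA leq_mul2l hle orbT.
by rewrite leq_pmul2r // /n; lia.
Qed.

(** [coef_ge0] applies to the difference; if the leading coefficients agree, their term drops out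
    and the second ones lead a combination of one degree less. *)
Lemma coef_le d (c c' : nat -> int) k0 :
  (forall k, (k0 <= k)%N ->
     \sum_(i < d.+2) c i * ('C(k + d.+1 - i - 1, d.+1 - i))%:Z <=
     \sum_(i < d.+2) c' i * ('C(k + d.+1 - i - 1, d.+1 - i))%:Z) ->
  c 0%N <= c' 0%N /\ (c 0%N = c' 0%N -> c 1%N <= c' 1%N).
Proof.
move=> h; have h' k : (k0 <= k)%N ->
    0 <= \sum_(i < d.+2) (c' i - c i) * ('C(k + d.+1 - i - 1, d.+1 - i))%:Z.
  move=> /h; rewrite -subr_ge0 -sumrB.
  by under eq_bigr do rewrite -mulrBl.
split; first by have := @coef_ge0 d.+1 (fun i => c' i - c i) k0 h'; rewrite subr_ge0.
move=> c0; rewrite -subr_ge0.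
apply: (@coef_ge0 d (fun i => c' i.+1 - c i.+1) k0) => k /h'.
rewrite big_ord_recl /= c0 subrr mul0r add0r.
under eq_bigr => i _.
  rewrite /bump add1n subSS.
  have -> : (k + d.+1 - i.+1 - 1 = k + d - i - 1)%N by have := ltn_ord i; lia.
  over.
by [].
Qed.

(** The default 0 of [nth] pads the list, giving a two-term bound the shape that [coef_le]
    expects. *)
Lemma sum_first_two d (A B : int) (f : nat -> int) :
  \sum_(i < d.+2) nth 0 [:: A; B] i * f i = A * f 0%N + B * f 1%N.
Proof.
rewrite !big_ord_recl big1 ?addr0 // => i _ /=.
by rewrite /bump !add1n /= nth_nil mul0r.
Qed.

(** Pascal's rule is applied [r] times; each increment is at most the last one. *)
Lemma bin_shift n r d :
  ('C(n + r + d, d.+1) <= 'C(n + d, d.+1) + r * 'C(n + r + d - 1, d))%N.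
Proof.
elim: r => [|r IH]; first by rewrite addn0 mul0n addn0.
rewrite addnS addSn binS subn1 /= mulSn addnCA addnC leq_add2l.
apply: (leq_trans IH); rewrite leq_add2l leq_mul2l; apply/orP; right.
by apply: leq_bin2l; rewrite leq_subLR leq_addl.
Qed.

End BinomialBasis.

(** * From bounds on the Hilbert polynomial to its first two coefficients *)

Section HilbertPolynomial.
Variables (d : nat) (e : nat -> int).
Implicit Types n r k : nat.
Let P k := \sum_(i < d.+2) (-1) ^+ i * e i * ('C(k + d.+1 - i - 1, d.+1 - i))%:Z.

(** By [bin_shift], the shift by [r] is absorbed by a second coefficient [- E * r], leaving the
    leading one untouched; without shift the second coefficients compare too. *)
Lemma hilbert_lower_bound E r k0 :
  (forall n, (k0 <= n)%N -> ((E * 'C(n + d, d.+1))%N%:Z <= P (n + r))) ->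
  E%:Z <= e 0%N /\ (r = 0%N -> e 0%N = E%:Z -> e 1%N <= 0).
Proof.
move=> h.
have [|h0 h1] := @coef_le d (nth 0 [:: E%:Z; - (E * r)%N%:Z]) (fun i => (-1) ^+ i * e i)
  (k0 + r).+1.
  move=> k hk.
  rewrite (@sum_first_two _ _ _ (fun i => ('C(k + d.+1 - i - 1, d.+1 - i))%:Z)).
  have [n kE hn] : exists2 n, k = (n + r)%N & (k0 <= n)%N by exists (k - r)%N; lia.
  rewrite kE; apply: le_trans (h n hn).
  rewrite !subn0 addnS !subSS !subn0.
  have := bin_shift n r d; set a := 'C(_, _); set b := 'C(_, _).
  set b' := 'C(_, _) => hab.
  rewrite mulNr lerBlDr -!PoszM -PoszD lez_nat -mulnA -mulnDr.
  by rewrite leq_mul2l hab orbT.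
split; first by move: h0; rewrite /= expr0 mul1r.
move=> r0 e0; move: h1; rewrite /= expr0 mul1r e0 => /(_ erefl).
by rewrite expr1 mulN1r r0 muln0 oppr0 oppr_ge0.
Qed.

Lemma hilbert_upper_bound E L k0 :
  (forall n, (k0 <= n)%N ->
     P n.+1 <= (E * 'C(n + d, d.+1) + L * 'C(n + d, d))%N%:Z) ->
  e 0%N <= E%:Z /\ (e 0%N = E%:Z -> E%:Z - L%:Z <= e 1%N).
Proof.
move=> h.
(* At [n + 1], Pascal's rule rewrites the bound with first coefficients [E] and [L - E]; since [e 1]
   enters with a minus sign, its bound is reversed. *)
have [|h0 h1] := @coef_le d (fun i => (-1) ^+ i * e i)
  (nth 0 [:: E%:Z; L%:Z - E%:Z]) k0.+1.
  move=> [//|n]; rewrite ltnS => hn; apply: (le_trans (h n hn)).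
  rewrite (@sum_first_two _ _ _ (fun i => ('C(n.+1 + d.+1 - i - 1, d.+1 - i))%:Z)).
  rewrite addSn addnS !subn0 !subSS !subn0.
  by rewrite binS; lia.
split; first by move: h0; rewrite /= expr0 mul1r.
move=> e0; move: h1; rewrite /= expr0 mul1r e0 => /(_ erefl).
by rewrite expr1 mulN1r; lia.
Qed.

End HilbertPolynomial.

(** * Assembly: the lengths compared with the Hilbert polynomial *)

Lemma krull_dim_inj (R : comNzRingType) d d' :
  krull_dim R d -> krull_dim R d' -> d = d'.
Proof.
by move=> [c h] [c' h']; apply/eqP; rewrite eqn_leq h' // h.
Qed.

Theorem corollary5p9 (R : comNzRingType) (m : set R) (d : nat)
    (hR : Cohen_Macaulay_local_ring m)
    (hinf : infinite_residue_field m)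
    (hdim : krull_dim R d) (hd : (0 < d)%N)
    (I : set R) (hI : primary_to m I)
    (x : d.-tuple R) (hx : system_of_parameters m x)
    (hred : reduction I (ideal_gen [set` x]))
    (M : lmodType R) (hM : maximal_Cohen_Macaulay m M)
    (e : nat -> int) (he : Hilbert_coefficients M I d e) :
  0 <= e 1%N /\
  (Ulrich M m I (ideal_gen [set` x]) <-> quot_free M I /\ e 1%N = 0).
Proof.
case: d hdim hd x hx hred he => [//|d] hdim _ x hx hred he.
set Q := ideal_gen [set` x].
have [noethR local_m _] := hR.
have [fgM [d1 hd1 [[ys [ysm ysreg ysd]] _]]] := hM.
have {hd1} dd1 : d1 = d.+1 := krull_dim_inj hd1 hdim.
have [QI [r hr]] := hred; rewrite -/Q in QI hr.
have [_ [[hQ _ _] radQ]] := hx; rewrite -/Q in hQ radQ.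
have hT := @submodule_setT _ M.
have hall : all_regular M x.
  apply: (all_regular_of_depth local_m (noetherian_module_fg noethR fgM) ysreg).
  - by rewrite ysd dd1 size_tuple.
  - move=> a ax; rewrite inE -radQ; exists 1%N; rewrite expr1.
    exact: sub_ideal_gen.
  - by move=> y /ysm; rewrite -radQ.
have hseq : adic_regular_seq [set (0 : M)] x.
  by apply: (all_regular_adic_seq (t := [::]) hall); rewrite cats0.
have IrQ n : iter (n + r) (smul I) [set: M] `<=` iter n (smul Q) [set: M].
  by rewrite (reduction_power M n hr); apply: iter_smulS.
have QM1 : smul Q [set: M] = seqmul x setT := smul_gen x hT.
have hQM : submodule (smul Q [set: M]) := smul_submodule _ _.
have hIM : submodule (smul I [set: M]) := smul_submodule _ _.
have QIM : smul Q [set: M] `<=` smul I [set: M] by apply: smulS.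
have {he} [k0 he] := he.
have hlen k : (k0 <= k)%N -> exists2 l : nat,
    quot_length (iter k (smul I) [set: M]) l &
    l%:Z = \sum_(i < d.+2) (-1) ^+ i * e i * ('C(k + d.+1 - i - 1, d.+1 - i))%:Z.
  by move=> /he; rewrite smul_exp.
have [E hE] : exists E, quot_length (smul Q [set: M]) E.
  (* This exponent is large enough both for the length to be finite and for [I^(k0 + 1 + r) M] to
     lie in [QM]. *)
  have [|l hl _] := hlen (k0 + (1 + r))%N; first exact: leq_addr.
  apply: (@quot_length_exists _ _ _ l hQM).
  apply: length_leS (quot_length_le hl).
  apply: subset_trans (IrQ 1%N); rewrite iterD.
  by apply: iter_smul_sub; apply: iter_smul_submodule.
have [L hL] : exists L, quot_length (smul I [set: M]) L.
  apply: (@quot_length_exists _ _ _ E hIM).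
  exact: length_leS QIM (quot_length_le hE).
have LE : (L <= E)%N.
  apply: (quot_length_le hE); have [/chain_betweenT cL _] := hL.
  exact: chain_betweenS cL.
have upper n : (k0 <= n)%N -> \sum_(i < d.+2) (-1) ^+ i * e i *
      ('C(n.+1 + d.+1 - i - 1, d.+1 - i))%:Z <=
    (E * 'C(n + d, d.+1) + L * 'C(n + d, d))%N%:Z.
  move=> hn; have [l [cl _] <-] := hlen n.+1 (leqW hn); rewrite lez_nat.
  rewrite -adic_hilbertE -(size_tuple x).
  have := @adic_length_le _ M [set 0] (smul I setT) x n E L
    (submodule_set0 _) hIM.
  rewrite !addset0l -QM1 -iter_smul_gen //; apply.
  - exact: quot_length_le.
  - exact: quot_length_le.
  have {}cl := (chain_betweenT _ _).1 cl.
  by apply: chain_betweenS cl => //; apply: iter_smul_mixed.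
(* The shift is kept general: [r] gives the bound on [e 0], and 0, available once [IM = QM], gives
   [e 1 <= 0]. *)
have lower s : (forall n, iter (n + s) (smul I) [set: M] `<=`
      iter n (smul Q) [set: M]) ->
    forall n, (k0 <= n)%N -> (E * 'C(n + d, d.+1))%N%:Z <=
      \sum_(i < d.+2) (-1) ^+ i * e i *
        ('C(n + s + d.+1 - i - 1, d.+1 - i))%:Z.
  move=> hs n hn; have [l hl <-] := hlen (n + s)%N (leq_trans hn (leq_addr _ _)).
  rewrite lez_nat; apply: (quot_length_le hl).
  have := @adic_length_chain _ M [set 0] x n E (submodule_set0 _) hseq.
  rewrite !addset0l -QM1 -iter_smul_gen // size_tuple adic_hilbertE mul0n addn0.
  by have [/chain_betweenT cE _] := hE => /(_ cE); apply: chain_betweenS.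
have [e0E _] := hilbert_lower_bound (lower r IrQ).
have [Ee0 northcott] := hilbert_upper_bound upper.
have {e0E Ee0} e0 : e 0%N = E%:Z by apply/eqP; rewrite eq_le Ee0.
have {}northcott := northcott e0.
have e1 : 0 <= e 1%N by apply: le_trans northcott; rewrite subr_ge0 lez_nat.
split=> //; split=> [[_ IQ free]|[free e10]].
  split=> //; apply/eqP; rewrite eq_le e1 andbT.
  have [|_ ->//] := hilbert_lower_bound (lower 0%N _).
  by move=> n; rewrite addn0 (iter_smul_eq _ IQ).
split=> //; apply/seteqP; split=> //; apply: contrapT => nIQ.
(* A strict inclusion of [QM] in [IM] would give [L < E], against [E - L <= e 1 = 0]. *)
have := quot_length_antitone hQM (conj QIM nIQ) hE hL.
by move: northcott; rewrite e10; lia.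
Qed.
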